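(* Assume $I(\omega)$. Then for every model $\mathcal A$ of cardinality $\omega_1$ the following conditions are equivalent: (i) $\sigma(\mathcal A)>\omega_1$; (ii) $\sigma(\mathcal A)=2^{\omega_1}$; (iii) $\mathcal A$ is perfect.
   Context: $\sigma(\mathcal A)$ denotes the number of automorphisms of $\mathcal A$. Models are structures for a vocabulary of finitary symbols. $I(\omega)$ is the assumption: there is a (proper) ideal $I$ on $\omega_2$ which is $\omega_2$-complete (closed under unions of at most $\omega_1$ members), normal, contains all singletons $\{\alpha\}$, $\alpha<\omega_2$, and such that $I^+=\{X\subseteq\omega_2 : X\notin I\}$ has a dense subset $K$ (i.e. $K\subseteq I^+$ and every $X\in I^+$ includes some $Y\in K$) with the property that every descending (under inclusion) chain of length $<\omega_1$ of elements of $K$ has a lower bound in $K$. Perfect models: for a model $\mathcal A$ of cardinality $\omega_1$, the game $G(\mathcal A)$ has $\omega_1$ moves and two players $\exists$ and $\forall$. During the game a countable partial isomorphism $\pi$ from $\mathcal A$ to $\mathcal A$ (a partial map preserving and reflecting atomic formulas) is extended, starting from $\pi=\emptyset$ and taking unions at limits. At each move $\forall$ first plays a point $x$ of $\mathcal A$ and says whether $x$ is to be in the domain or in the range of the extension. Then $\exists$ must produce two contradictory countable partial isomorphisms $\pi',\pi''$ extending $\pi$, both having $x$ in the domain (respectively range); contradictory means that no partial isomorphism extends both $\pi'$ and $\pi''$. Then $\forall$ chooses one of $\pi',\pi''$ with which the game goes on. $\exists$ wins if he can play all $\omega_1$ moves. $\mathcal A$ is perfect if $\exists$ has a winning strategy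 in $G(\mathcal A)$. *)

(* Defs.v *)
From mathcomp Require Import all_boot all_order.
From mathcomp Require Import boolp classical_sets functions cardinality.

Set Implicit Arguments.
Unset Strict Implicit.
Unset Printing Implicit Defensive.

Local Open Scope order_scope.
Local Open Scope classical_set_scope.
Local Open Scope card_scope.

Definition card_lt T U (A : set T) (B : set U) : Prop :=
  A #<= B /\ ~ (B #<= A).
Notation "A '#<' B" := (card_lt A B) (at level 79) : card_scope.

(* [W] has the order type of the cardinal successor of [|T|] (for infinite T):
   it is a well-order not injecting into T all of whose proper initial segments
   do. This determines W up to a unique order isomorphism, and such a W always
   exists (Hartogs). *)
Definition is_succ_cardinal d (W : orderType d) (T : Type) : Prop :=
  [/\ well_founded (fun a b : W => a < b),
      ~ ([set: W] #<= [set: T]) &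
      forall a : W, [set b : W | b < a] #<= [set: T]].

Definition is_omega1 d (W1 : orderType d) : Prop := is_succ_cardinal W1 nat.

Definition is_omega2 d1 (W1 : orderType d1) d2 (W2 : orderType d2) : Prop :=
  is_succ_cardinal W2 W1.

Definition proper_ideal (T : Type) (I : set (set T)) : Prop :=
  [/\ I set0,
      forall X Y : set T, Y `<=` X -> I X -> I Y,
      forall X Y : set T, I X -> I Y -> I (X `|` Y) &
      ~ I [set: T]].

(* |S|^+ - completeness. *)
Definition closed_under_unions (S T : Type) (I : set (set T)) : Prop :=
  forall J : set (set T), J `<=` I -> J #<= [set: S] -> I (\bigcup_(X in J) X).

(* Dual of the closure of normal filters under diagonal intersections. *)
Definition normal_ideal d (W : orderType d) (I : set (set W)) : Prop :=
  forall X : W -> set W, (forall a, I (X a)) ->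
    I [set b | exists2 a, a < b & X a b].

Definition positive (T : Type) (I : set (set T)) : set (set T) :=
  [set X | ~ I X].

Definition dense_in (T : Type) (P K : set (set T)) : Prop :=
  K `<=` P /\ forall X, P X -> exists2 Y, K Y & Y `<=` X.

(* A chain of length [l], for l an element of [W1] identified with the ordinal
   of its initial segment, is given by the values [C a] for a < l. *)
Definition chains_bounded d (W1 : orderType d) (T : Type)
    (K : set (set T)) : Prop :=
  forall (l : W1) (C : W1 -> set T),
    (forall a, a < l -> K (C a)) ->
    (forall a b, a <= b -> b < l -> C b `<=` C a) ->
    exists2 Y, K Y & forall a, a < l -> Y `<=` C a.

Definition I_omega d1 (W1 : orderType d1) d2 (W2 : orderType d2) : Prop :=
  exists I : set (set W2),
    [/\ proper_ideal I,
        closed_under_unions W1 I,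
        normal_ideal I,
        forall a : W2, I [set a] &
        exists2 K : set (set W2),
          dense_in (positive I) K & chains_bounded W1 K].

Record vocabulary := Vocabulary {
  fsym : Type;
  farity : fsym -> nat;
  rsym : Type;
  rarity : rsym -> nat }.

Record model (L : vocabulary) := Model {
  carrier :> Type;
  finterp : forall f : fsym L, ('I_(farity f) -> carrier) -> carrier;
  rinterp : forall r : rsym L, ('I_(rarity r) -> carrier) -> Prop }.

Inductive term (L : vocabulary) (n : nat) : Type :=
| Tvar of 'I_n
| Tapp (f : fsym L) of ('I_(farity f) -> term L n).

Inductive atomic (L : vocabulary) (n : nat) : Type :=
| Aeq of term L n & term L n
| Arel (r : rsym L) of ('I_(rarity r) -> term L n).

Fixpoint eval L (A : model L) n (v : 'I_n -> A) (t : term L n) : A :=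
  match t with
  | Tvar i => v i
  | Tapp f ts => finterp (fun i => eval v (ts i))
  end.

Definition sat L (A : model L) n (v : 'I_n -> A) (phi : atomic L n) : Prop :=
  match phi with
  | Aeq s t => eval v s = eval v t
  | Arel r ts => rinterp (fun i => eval v (ts i))
  end.

Definition automorphisms L (A : model L) : set (A -> A) :=
  [set g | [/\ bijective g,
    forall (f : fsym L) (x : 'I_(farity f) -> A),
      g (finterp x) = finterp (g \o x) &
    forall (r : rsym L) (x : 'I_(rarity r) -> A),
      rinterp x <-> rinterp (g \o x)]].
Arguments automorphisms [L] A _.

(* Partial maps are represented by their graphs. The domain of a partial
   isomorphism need not be closed under the function symbols. *)
Definition partial_iso L (A : model L) (p : set (A * A)) : Prop :=
  (forall x y z, p (x, y) -> p (x, z) -> y = z) /\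
  (forall n (phi : atomic L n) (v w : 'I_n -> A),
     (forall i, p (v i, w i)) -> (sat v phi <-> sat w phi)).

Definition contradictory L (A : model L) (p q : set (A * A)) : Prop :=
  ~ exists r : set (A * A), [/\ partial_iso r, p `<=` r & q `<=` r].

Section Game.
Context d (W1 : orderType d) (L : vocabulary) (A : model L).

Variant side := InDomain | InRange.

Definition covers (c : A * side) (p : set (A * A)) : Prop :=
  match c.2 with
  | InDomain => exists y, p (c.1, y)
  | InRange => exists y, p (y, c.1)
  end.

(* The moves of player forall in a whole play: in round [a] he first makes a
   challenge, then picks one of the two extensions offered by player exists,
   [true] for the first and [false] for the second. *)
Definition challenges := W1 -> A * side.
Definition choices := W1 -> bool.

Definition answer := (set (A * A) * set (A * A))%type.

Definition chosen (r : answer) (b : bool) : set (A * A) :=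
  if b then r.1 else r.2.

Definition strategy := W1 -> challenges -> choices -> answer.

(* The answer [tau a c s] of player exists in round [a] depends only on the
   moves already made: the challenges up to round a included and the choices made before round a. *)
Definition nonanticipating (tau : strategy) : Prop :=
  forall (a : W1) (c c' : challenges) (s s' : choices),
    (forall b, b <= a -> c b = c' b) -> (forall b, b < a -> s b = s' b) ->
    tau a c s = tau a c' s'.

(* The partial isomorphism reached before round [a]: empty at the first round,
   the last chosen extension at a successor, the union at a limit. As legal
   answers extend the current position, one formula covers the three cases. *)
Definition position (tau : strategy) (c : challenges) (s : choices) (a : W1) :
    set (A * A) :=
  \bigcup_(b in [set b | b < a]) chosen (tau b c s) (s b).

Definition legal_extension (p : set (A * A)) (c : A * side)
    (q : set (A * A)) : Prop :=
  [/\ partial_iso q, countable q, p `<=` q & covers c q].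

Definition legal_answer (p : set (A * A)) (c : A * side) (r : answer) : Prop :=
  [/\ legal_extension p c r.1, legal_extension p c r.2 &
      contradictory r.1 r.2].

Definition winning (tau : strategy) : Prop :=
  forall (c : challenges) (s : choices) (a : W1),
    legal_answer (position tau c s a) (c a) (tau a c s).

Definition perfect : Prop :=
  exists2 tau : strategy, nonanticipating tau & winning tau.

End Game.

(* Main.v *)
Require Import Defs.
From mathcomp Require Import all_boot all_order.
From mathcomp Require Import boolp classical_sets functions cardinality.

Set Implicit Arguments.
Unset Strict Implicit.
Unset Printing Implicit Defensive.

Import Order.TTheory.

(* From more than omega_1 automorphisms pick distinct [f_xi], xi < omega_2.
   Player exists keeps, next to the position [p], a set [X] in the dense set
   [K] such that every [f_xi], xi in [X], extends [p]; at limits the chain of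
   these sets has a lower bound in [K]. By completeness of the ideal, some point
   has two different images under positively many [f_xi], which gives two
   contradictory extensions. Conversely, if forall challenges every point on
   both sides, then each sequence of his choices leads to an automorphism of the
   model, and different sequences lead to different automorphisms. *)

Local Open Scope order_scope.
Local Open Scope classical_set_scope.
Local Open Scope card_scope.

(** * Well-founded recursion and comparison of cardinals *)

(** Masking the values from [a] on by [x0] lets [F] take a total function, so that no dependent
    types appear in later recursions. *)
Lemma wf_recursion d (W : orderType d) (T : Type) (x0 : T)
    (F : W -> (W -> T) -> T) : well_founded (fun a b : W => a < b) ->
  exists g : W -> T, forall a, g a = F a (fun b => if b < a then g b else x0).
Proof.
move=> wfW.
pose G a (rec : forall b, b < a -> T) :=
  F a (fun b => if pselect (b < a) is left h then rec b h else x0).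
exists (Fix wfW (fun _ => T) G) => a.
rewrite Fix_eq; last first.
  move=> x f g fg; congr F; apply/funext => b; case: pselect => // h; exact: fg.
by congr F; apply/funext => b; case: pselect => [->//|/negP/negbTE ->].
Qed.

Lemma card_le_fun (T U : Type) (A : set T) (B : set U) (u0 : U) :
  A #<= B -> exists2 f : T -> U, {in A &, injective f} & forall x, A x -> B (f x).
Proof.
elim/Ppointed: U => U in B u0 *; first by case: (no u0).
move=> /pcard_leP[f]; exists f; first exact: inj.
by move=> x; exact: funS.
Qed.

Lemma fun_card_le (T U : Type) (A : set T) (B : set U) (f : T -> U) :
  {in A &, injective f} -> (forall x, A x -> B (f x)) -> A #<= B.
Proof.
move=> injf AB.
by rewrite -(card_le_eql (inj_card_eq injf)); apply: subset_card_le => _ [x /AB ? <-].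
Qed.

Lemma inj_card_leT (T U : Type) (f : T -> U) :
  injective f -> [set: T] #<= [set: U].
Proof. by move=> injf; apply: (@fun_card_le _ _ _ _ f) => // x y _ _ /injf. Qed.

Lemma card_leT_inj (T U : Type) (u0 : U) :
  [set: T] #<= [set: U] -> exists f : T -> U, injective f.
Proof.
move=> /(card_le_fun u0)[f injf _]; exists f => x y.
by apply: injf; rewrite inE.
Qed.

Lemma surj_card_le (T U : Type) (f : U -> T) (A : set T) :
  (forall x, A x -> exists u, f u = x) -> A #<= [set: U].
Proof.
move=> surjf; apply: (card_le_trans _ (card_image_le f setT)).
by apply: subset_card_le => x /surjf[u <-]; exists u.
Qed.

Lemma Cantor (T : Type) : ~ ([set: set T] #<= [set: T]).
Proof.
move=> le.
have [t0] : exists t : T, True.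
  apply: contrapT => noT.
  have /card_leP[f] := le.
  by apply: noT; exists (val (f (SigSub (mem_set (I : [set: set T] set0))))).
move=> _; have [f injf] := card_leT_inj t0 le.
pose D := [set f X | X in [set X : set T | ~ X (f X)]].
have nD : ~ D (f D) by move=> /[dup] DfD [X nX] /injf XD; apply: nX; rewrite XD.
by apply: (nD); exists D.
Qed.

(** By transfinite recursion, stage [a] picks a point of [S] different from all earlier ones: these
    form a set no larger than [U], so they cannot exhaust [S]. *)
Lemma wo_embedding d (W : orderType d) (T U : Type) (S : set T) :
    well_founded (fun a b : W => a < b) ->
    (forall a : W, [set b : W | b < a] #<= [set: U]) -> ~ (S #<= [set: U]) ->
  exists2 f : W -> T, injective f & forall a, S (f a).
Proof.
move=> wfW small large.
have [t0 St0] : exists t, S t.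
  apply: contrapT => nS; apply: large.
  suff -> : S = set0 by exact: card_ge0.
  by apply/seteqP; split => // t St; case: nS; exists t.
have fresh (p : W * (W -> T)) :
    exists t, S t /\ forall b, b < p.1 -> t <> p.2 b.
  apply: contrapT => no; apply: large.
  apply: card_le_trans (small p.1); apply: card_le_trans (card_image_le p.2 _).
  apply: subset_card_le => t St; apply: contrapT => nt; apply: no.
  by exists t; split=> // b lb tb; apply: nt; exists b.
have [F F_fresh] := choice fresh.
have [f fE] := wf_recursion t0 (fun a h => F (a, h)) wfW.
have f_fresh a b : b < a -> f a <> f b.
  move=> lba; rewrite [f a]fE.
  have [_ /(_ b lba)] := F_fresh (a, fun b => if b < a then f b else t0).
  by rewrite /= lba.
exists f; last first.
  move=> a; rewrite fE.
  by case: (F_fresh (a, fun b => if b < a then f b else t0)).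
by move=> a b fab; case: (ltgtP a b) => // /f_fresh; [case | rewrite fab].
Qed.

(** * Cardinal arithmetic of the first uncountable cardinal *)

Section Omega1.
Context d (W1 : orderType d) (omega1_W1 : is_omega1 W1).

Let wf_omega1 : well_founded (fun a b : W1 => a < b).
Proof. by case: omega1_W1. Qed.

Lemma omega1_uncountable : ~ countable [set: W1].
Proof. by case: omega1_W1. Qed.

Lemma countable_lt (a : W1) : countable [set b | b < a].
Proof. by case: omega1_W1 => _ _; apply. Qed.

Lemma omega1_inhabited : exists a : W1, True.
Proof.
apply: contrapT => noW; apply: omega1_uncountable.
suff -> : [set: W1] = set0 by exact: countable0.
by apply/seteqP; split => // w _; case: noW; exists w.
Qed.

Lemma countable_le (a : W1) : countable [set b | b <= a].
Proof.
have -> : [set b | b <= a] = [set a] `|` [set b | b < a].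
  apply/seteqP; split => b /=; rewrite le_eqVlt.
    by case/orP => [/eqP|]; [left|right].
  by case=> [->|->]; rewrite ?eqxx ?orbT.
rewrite -bigcup2E; apply: bigcup_countable => [|i _]; first exact: countableP.
by case: i => [|[|i]] /=; [exact: countable1 | exact: countable_lt | exact: countable0].
Qed.

(* The fibres are embedded one after the other, each into the uncountable
   complement of the images of the previous ones. *)
Lemma countable_to_one_card_le (X : Type) (rk : X -> W1) :
  (forall a, countable (rk @^-1` [set a])) -> [set: X] #<= [set: W1].
Proof.
move=> cfib; have [w0 _] := omega1_inhabited.
have step (p : W1 * (W1 -> X -> W1)) : exists h : X -> W1,
    {in rk @^-1` [set p.1] &, injective h} /\
    forall x y, rk x = p.1 -> rk y < p.1 -> h x <> p.2 (rk y) y.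
  case: p => a H /=.
  pose V := \bigcup_(b in [set b | b < a]) H b @` (rk @^-1` [set b]).
  have cV : countable V.
    apply: bigcup_countable; first exact: countable_lt.
    by move=> b _; apply: card_le_trans (card_image_le _ _) (cfib b).
  have infV : infinite_set (~` V).
    move=> /finite_set_countable cCV; apply: omega1_uncountable.
    rewrite -(setUv V) -bigcup2E.
    apply: bigcup_countable => [|i _]; first exact: countableP.
    by case: i => [|[|i]] //=.
  have [h injh hV] := card_le_fun w0
    (card_le_trans (cfib a) ((infiniteP _).1 infV)).
  exists h; split=> // x y xa ya hxy; apply: (hV x xa).
  by exists (rk y) => //; exists y.
have [F F_spec] := choice step.
have [g gE] := wf_recursion (fun=> w0) (fun a h => F (a, h)) wf_omega1.
have g_inj a : {in rk @^-1` [set a] &, injective (g a)}.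
  by rewrite gE; case: (F_spec (a, fun b => if b < a then g b else fun=> w0)).
have g_fresh x y : rk y < rk x -> g (rk x) x <> g (rk y) y.
  move=> yx; rewrite [g (rk x)]gE.
  have [_ /(_ x y erefl yx)] :=
    F_spec (rk x, fun b => if b < rk x then g b else fun=> w0).
  by rewrite /= yx.
apply: (@inj_card_leT _ _ (fun x => g (rk x) x)) => x y gxy.
case: (ltgtP (rk x) (rk y)) => [/g_fresh|/g_fresh|]; rewrite ?gxy // => rxy.
by apply: (g_inj (rk x)); rewrite ?inE //= ?rxy // -gxy rxy.
Qed.

(** Ranked by the maximum of its coordinates, a pair of rank [a] lies in the square of a countable
    initial segment, so all fibres are countable. *)
Lemma card_omega1_square : [set: W1 * W1] #<= [set: W1].
Proof.
apply: (@countable_to_one_card_le _ (fun p => Order.max p.1 p.2)) => a.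
apply: card_le_trans (countableX (countable_le a) (countable_le a)).
apply: subset_card_le => -[x y] /= <-.
by split; rewrite /= le_max lexx ?orbT.
Qed.

End Omega1.

(** * Partial isomorphisms and automorphisms *)

Definition graph T U (g : T -> U) : set (T * U) := [set p | g p.1 = p.2].

Section PartialIsomorphisms.
Context (L : vocabulary) (A : model L).

Lemma sub_partial_iso (p q : set (A * A)) :
  p `<=` q -> partial_iso q -> partial_iso p.
Proof.
move=> pq [qfun qsat]; split=> [x y z /pq xy /pq|]; first exact: qfun.
by move=> n phi v w vw; apply: qsat => i; apply: pq.
Qed.

Lemma automorphism_eval (g : A -> A) n (v : 'I_n -> A) (t : term L n) :
  automorphisms A g -> g (eval v t) = eval (g \o v) t.
Proof.
move=> [_ gfun _]; elim: t => [//|f ts IH] /=.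
by rewrite gfun; congr finterp; apply/funext.
Qed.

Lemma automorphism_partial_iso (g : A -> A) :
  automorphisms A g -> partial_iso (graph g).
Proof.
move=> autg; split=> [x y z|n phi v w vw]; first by rewrite /graph /= => -> ->.
have -> : w = g \o v by apply/funext => i; exact/esym/(vw i).
case: (autg) => bijg _ grel; case: phi => [s t|r ts] /=.
  by rewrite -!automorphism_eval //; split=> [->//|/(bij_inj bijg)].
rewrite grel; set x := g \o _; set y := fun i => _.
suff -> : x = y by [].
by apply/funext => i; rewrite /x /= automorphism_eval.
Qed.

(** Three kinds of atomic formulas suffice: [x = y] for injectivity, [f(x) = y] for the function
    symbols, [r(x)] for the relation symbols. *)
Lemma partial_iso_automorphism (g : A -> A) :
  partial_iso (graph g) -> (forall y, exists x, g x = y) -> automorphisms A g.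
Proof.
move=> [_ gsat] surjg.
have injg : injective g.
  move=> x y gxy.
  pose v (i : 'I_2) := if i == ord0 then x else y.
  have [_] := gsat 2 (Aeq (Tvar L ord0) (Tvar L ord_max)) v (g \o v) (fun=> erefl).
  exact.
split.
- have [h hK] := choice surjg.
  by exists h => // x; apply: injg; rewrite hK.
- move=> f x.
  (* The last variable holds the value of [f], the others its arguments. *)
  pose v (i : 'I_(farity f).+1) := if unlift ord_max i is Some j then x j else finterp x.
  pose phi := Aeq (Tapp (fun j => Tvar L (lift ord_max j))) (Tvar L (@ord_max (farity f))).
  have [sat_v _] := gsat _ phi v (g \o v) (fun=> erefl).
  have vlift j : v (lift ord_max j) = x j by rewrite /v liftK.
  have vmax : v ord_max = finterp x by rewrite /v unlift_none.
  rewrite -vmax -[g _]sat_v /=; last first.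
    by rewrite vmax; congr finterp; apply/funext => j; rewrite vlift.
  by congr finterp; apply/funext => j /=; rewrite vlift.
- move=> r x; exact: (gsat _ (Arel (@Tvar L _)) x (g \o x) (fun=> erefl)).
Qed.

(** An atomic formula has finitely many variables, so all the pairs involved already lie in a single
    [P a]. The point [w0] is needed for the maximum of an empty family. *)
Lemma directed_partial_iso d (W : orderType d) (w0 : W) (P : W -> set (A * A)) :
    (forall a, partial_iso (P a)) -> (forall a b, a <= b -> P a `<=` P b) ->
  partial_iso (\bigcup_a P a).
Proof.
move=> isoP monoP; split=> [x y z [a _ Pa] [b _ Pb]|n phi v w vw].
  have [+ _] := isoP (Order.max a b); apply.
    by apply: monoP Pa; rewrite le_max lexx.
  by apply: monoP Pb; rewrite le_max lexx orbT.
have /choice[rk rkP] : forall i, exists a, P a (v i, w i).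
  by move=> i; have [a _ ?] := vw i; exists a.
have [_ satP] := isoP (\big[Order.max/w0]_i rk i).
by apply: satP => i; apply: monoP (rkP i); exact: le_bigmax.
Qed.

End PartialIsomorphisms.

(** * Automorphisms built by plays of a winning strategy *)

Section Play.
Context d (W1 : orderType d) (omega1_W1 : is_omega1 W1).
Context (L : vocabulary) (A : model L) (tau : strategy W1 A).
Hypotheses (na_tau : nonanticipating tau) (win_tau : winning tau).
Variable c : challenges W1 A.
Hypothesis c_surj : forall ch, exists a, c a = ch.

Let P (s : choices W1) a : set (A * A) := chosen (tau a c s) (s a).

Let P_legal s a : legal_extension (position tau c s a) (c a) (P s a).
Proof. by rewrite /P; case: (win_tau c s a) => ? ? _; case: (s a). Qed.

Let P_mono s a b : a <= b -> P s a `<=` P s b.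
Proof.
rewrite le_eqVlt => /orP[/eqP -> //|ab].
have [_ _ + _] := P_legal s b; apply: subset_trans.
exact: (bigcup_sup (i := a)).
Qed.

(** Each point is challenged on both sides at some round, which makes the union of the play total
    and surjective. *)
Lemma play_automorphism s :
  exists2 g, automorphisms A g & forall a, P s a `<=` graph g.
Proof.
have [w0 _] := omega1_inhabited omega1_W1.
have isoU : partial_iso (\bigcup_a P s a).
  by apply: (directed_partial_iso w0) => [a|]; [case: (P_legal s a) | exact: P_mono].
have tot x : exists y, (\bigcup_a P s a) (x, y).
  have [a ca] := c_surj (x, InDomain).
  by have [_ _ _] := P_legal s a; rewrite ca => -[y Py]; exists y, a.
have [g gU] := choice tot.
have UE : \bigcup_a P s a = graph g.
  apply/seteqP; split=> [[x y] Uxy|[x y]]; last by rewrite /graph /= => <-; exact: gU.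
  by have [+ _] := isoU; apply; [exact: gU | exact: Uxy].
exists g; last by move=> a; rewrite -UE; exact: bigcup_sup.
apply: partial_iso_automorphism; first by rewrite -UE.
move=> y; have [a ca] := c_surj (y, InRange).
have [_ _ _] := P_legal s a; rewrite ca => -[x Px]; exists x.
by have [+ _] := isoU; apply; [exact: gU | exists a].
Qed.

Lemma card_choices_automorphisms : [set: choices W1] #<= automorphisms A.
Proof.
have /choice[g gP] : forall s, exists g,
    automorphisms A g /\ forall a, P s a `<=` graph g.
  by move=> s; have [g ? ?] := play_automorphism s; exists g.
apply: (@fun_card_le _ _ _ _ g) => [s s' _ _ ggs|s _]; last by case: (gP s).
apply/funext; have [wfW _ _] := omega1_W1.
elim/(well_founded_ind wfW) => a IH.
have tauE : tau a c s = tau a c s' by exact: na_tau.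
(* The choices agree before [a], so the same two extensions are offered in round [a]. If the choices
   differed there, the graph of the common automorphism would extend both, although they are
   contradictory. *)
apply: contrapT => /eqP nss; have [_ _] := win_tau c s a; apply.
exists (graph (g s)); split; first by apply: automorphism_partial_iso; case: (gP s).
all: have [_ /(_ a)] := gP s; have [_ /(_ a)] := gP s'; rewrite /P -ggs -tauE.
all: by move: nss; case: (s a) (s' a) => -[].
Qed.

End Play.

Lemma perfect_card_automorphisms d (W1 : orderType d) (L : vocabulary) (A : model L) :
    is_omega1 W1 -> [set: A] #= [set: W1] -> perfect W1 A ->
  automorphisms A #= [set: set W1].
Proof.
move=> omega1_W1 /card_eqPle[leAW leWA] [tau na_tau win_tau].
have [w0 _] := omega1_inhabited omega1_W1.
have [j injj] := card_leT_inj w0 leAW.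
have [pair inj_pair] := card_leT_inj w0 (card_omega1_square omega1_W1).
apply: Cantor_Bernstein.
  (* Upper bound: an automorphism is coded by its graph, carried into [W1] by the injections [j] and
     [pair]. *)
  apply: (@fun_card_le _ _ _ _ (fun g => [set pair (j x, j (g x)) | x in setT])) => //.
  move=> g h _ _ gh; apply/funext => x.
  have : [set pair (j x, j (g x)) | x in setT] (pair (j x, j (g x))) by exists x.
  by rewrite gh => -[y _ /inj_pair[/injj -> /injj]].
have [w1 w01] : exists w1, w1 <> w0.
  apply: contrapT => now; apply: (omega1_uncountable omega1_W1).
  suff -> : [set: W1] = [set w0] by exact: countable1.
  by apply/seteqP; split=> // w _; apply: contrapT => ?; apply: now; exists w.
(* Lower bound: [code] injects the challenges into [W1], with [w0] and [w1] marking the side. A left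
   inverse of it, with a dummy value off its range, lists all challenges. *)
pose code (ch : A * side) := pair (j ch.1, if ch.2 is InDomain then w0 else w1).
have inj_code : injective code.
  move=> [x [] ] [y [] ] /inj_pair[/injj -> //] w; case: w01; exact: esym || exact: w.
have [a0 _] : exists a0 : A, True.
  apply: contrapT => noA; have A0 : [set: A] = set0.
    by apply/seteqP; split=> // a _; apply: noA; exists a.
  move: leWA; rewrite A0 => /card_le0P W0.
  by have : [set: W1] w0 by []; rewrite W0.
have decode w : exists ch, forall ch', code ch' = w -> ch = ch'.
  have [[ch <-]|now] := pselect (exists ch, code ch = w).
    by exists ch => ch' /inj_code.
  by exists (a0, InDomain) => ch' chw; case: now; exists ch'.
have [c cP] := choice decode.
have c_surj ch : exists a, c a = ch by exists (code ch); exact: cP.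
have := card_choices_automorphisms omega1_W1 na_tau win_tau c_surj.
apply: card_le_trans.
apply: (@inj_card_leT _ _ (fun (X : set W1) w => w \in X)) => X Y XY.
by apply/seteqP; split=> w; move: (congr1 (@^~ w) XY) => /= XYw /mem_set;
  [rewrite XYw|rewrite -XYw] => /set_mem.
Qed.

(** * A winning strategy from the ideal *)

Section StrategyFromIdeal.
Context d1 d2 (W1 : orderType d1) (W2 : orderType d2).
Context (L : vocabulary) (A : model L) (I K : set (set W2)).
Hypothesis omega1_W1 : is_omega1 W1.
Hypothesis le_A_W1 : [set: A] #<= [set: W1].
Hypothesis ideal_I : proper_ideal I.
Hypothesis complete_I : closed_under_unions W1 I.
Hypothesis singletons_I : forall a : W2, I [set a].
Hypothesis dense_K : dense_in (positive I) K.
Hypothesis bounded_K : chains_bounded W1 K.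
Variable f : W2 -> A -> A.
Hypothesis inj_f : injective f.
Hypothesis aut_f : forall xi, automorphisms A (f xi).

Lemma ideal_bigcup (F : A -> set W2) : (forall x, I (F x)) -> I (\bigcup_x F x).
Proof.
move=> IF; have -> : \bigcup_x F x = \bigcup_(X in range F) X by rewrite bigcup_image.
apply: complete_I; first by move=> _ [x _ <-].
exact: card_le_trans (card_image_le _ _) le_A_W1.
Qed.

(** The fibres of [h] are indexed by [A], hence at most [W1] many; if all were in [I], completeness
    would put [Z] in [I]. *)
Lemma positive_fibre (Z : set W2) (h : W2 -> A) :
  positive I Z -> exists y, positive I (Z `&` [set xi | h xi = y]).
Proof.
move=> posZ; apply: contrapT => no; apply: posZ.
have [_ Isub _ _] := ideal_I.
apply: (Isub (\bigcup_y (Z `&` [set xi | h xi = y]))).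
  by move=> xi Zxi; exists (h xi).
by apply: ideal_bigcup => y; apply: contrapT => posy; apply: no; exists y.
Qed.

(* If almost all of the automorphisms took the same value at [x], for every
   [x], then almost all of them would be equal. *)
Lemma positive_split (Z : set W2) : positive I Z ->
  exists x y1 y2, [/\ y1 <> y2, positive I (Z `&` [set xi | f xi x = y1]) &
    positive I (Z `&` [set xi | f xi x = y2])].
Proof.
move=> posZ; apply: contrapT => no; apply: (posZ).
have [I0 Isub IU _] := ideal_I.
(* [g x] is a value taken positively often at [x]. Without a splitting every other value is taken
   only on a set in [I]. *)
have /choice[g gP] := fun x => positive_fibre (fun xi => f xi x) posZ.
have Ig x : I (Z `&` [set xi | f xi x <> g x]).
  apply: (Isub (\bigcup_y (if pselect (y = g x) then set0
                           else Z `&` [set xi | f xi x = y]))).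
    by move=> xi [Zxi nfg]; exists (f xi x) => //; case: pselect.
  apply: ideal_bigcup => y; case: pselect => // nyg.
  by apply: contrapT => posy; apply: no; exists x, y, (g x).
(* Outside the exceptional sets [f xi] equals [g], which by injectivity of [f] holds for at most one
   [xi]. *)
apply: (Isub (\bigcup_x (Z `&` [set xi | f xi x <> g x]) `|` [set xi | f xi = g])).
  move=> xi Zxi; have [fg|nfg] := pselect (f xi = g); [by right | left].
  apply: contrapT => nx; apply: nfg; apply/funext => x.
  by apply: contrapT => nfg; apply: nx; exists x.
apply: (IU); first exact: ideal_bigcup.
have [[xi fg]|none] := pselect (exists xi, f xi = g).
  apply: Isub (singletons_I xi) => xi' fg'.
  by apply: inj_f; rewrite fg' fg.
by apply: Isub I0 => xi fg; case: none; exists xi.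
Qed.

(** Passing to a positive fibre of the image of the challenged point, or of its preimage for a range
    challenge, makes all remaining automorphisms share one pair [z]. Density then shrinks the fibre
    to a member of [K]. *)
Lemma dense_cover (Z : set W2) (ch : A * side) : positive I Z ->
  exists Y z, [/\ K Y, Y `<=` Z, forall xi, Y xi -> graph (f xi) z & covers ch [set z]].
Proof.
move=> posZ; have [_ Kdense] := dense_K; case: ch => x [].
  have [y /Kdense[Y KY sYZ]] := positive_fibre (fun xi => f xi x) posZ.
  exists Y, (x, y); split=> // [xi /sYZ[]|xi /sYZ[] //|]; first by [].
  by exists y.
have /choice[h hP] : forall xi, exists u, f xi u = x.
  by move=> xi; have [[g _ gK] _ _] := aut_f xi; exists (g x).
have [u /Kdense[Y KY sYZ]] := positive_fibre h posZ.
exists Y, (u, x); split=> // [xi /sYZ[]|xi /sYZ[_ <-]|]; [by []|exact: hP|].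
by exists u.
Qed.

Definition state : Type := set (A * A) * set W2.

Definition coherent (r : state) : Prop :=
  [/\ K r.2, countable r.1 & forall xi, r.2 xi -> r.1 `<=` graph (f xi)].

(** [H] is the history of the play; only its values before round [a] matter. *)
Definition continues (a : W1) (ch : A * side) (H : W1 -> state) (r : state) : Prop :=
  [/\ coherent r, forall b, b < a -> r.2 `<=` (H b).2 &
    legal_extension (\bigcup_(b in [set b | b < a]) (H b).1) ch r.1].

Lemma next_states (a : W1) (ch : A * side) (H : W1 -> state) :
    (forall b, b < a -> coherent (H b)) ->
    (forall b b', b <= b' -> b' < a -> (H b').2 `<=` (H b).2) ->
  exists r : state * state, [/\ continues a ch H r.1, continues a ch H r.2 &
    contradictory r.1.1 r.2.1].
Proof.
move=> cohH monoH.
(* One lower bound serves successor and limit rounds alike; in the first round the chain is empty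
   and the bound is just some member of [K]. *)
have [|Z KZ ZH] := bounded_K (l := a) (C := fun b => (H b).2) _ monoH.
  by move=> b /cohH[].
pose p := \bigcup_(b in [set b | b < a]) (H b).1.
have cp : countable p.
  by apply: bigcup_countable => [|b /cohH[]//]; exact: countable_lt.
have pf xi : Z xi -> p `<=` graph (f xi).
  move=> Zxi z [b ba]; have [_ _] := cohH b ba; apply; exact: ZH.
have [Kpos _] := dense_K.
have [x [y1 [y2 [y12 pos1 pos2]]]] := positive_split (Kpos _ KZ).
(* The pair [(x, y)] separates the two extensions and [z] meets the challenge. As [Y] is positive it
   is nonempty, and any [xi] in it shows that the new position is a partial isomorphism. *)
have next y : positive I (Z `&` [set xi | f xi x = y]) ->
    exists r : state, continues a ch H r /\ r.1 (x, y).
  move=> /(dense_cover ch)[Y [z [KY YZ Yz chz]]].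
  have qf xi : Y xi -> p `|` [set (x, y); z] `<=` graph (f xi).
    move=> Yxi w; have [Zxi fxi] := YZ xi Yxi.
    by case=> [|[->|->]]; [exact: pf | | exact: Yz].
  have [xi Yxi] : exists xi, Y xi.
    apply: contrapT => noY; have [I0 _ _ _] := ideal_I; apply: (Kpos _ KY).
    suff -> : Y = set0 by [].
    by apply/seteqP; split=> // xi Yxi; case: noY; exists xi.
  have cq : countable (p `|` [set (x, y); z]).
    rewrite -bigcup2E; apply: bigcup_countable => [|i _]; first exact: countableP.
    case: i => [|[|i]] //=; apply: finite_set_countable; exact: finite_set2.
  exists (p `|` [set (x, y); z], Y); split; last by right; left.
  split=> [|b ba xi' /YZ[Zxi' _]|]; [by split | exact: (ZH b) | split=> //].
  - exact: sub_partial_iso (qf xi Yxi) (automorphism_partial_iso (aut_f xi)).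
  - by move=> w pw; left.
  - by move: chz; rewrite /covers; case: ch.2 => -[u zu]; exists u; right; right.
have [r1 [cont1 r1y]] := next _ pos1; have [r2 [cont2 r2y]] := next _ pos2.
exists (r1, r2); split=> //= -[r [[funr _] /(_ _ r1y) ry1 /(_ _ r2y) ry2]].
exact/y12/(funr x).
Qed.

Lemma ideal_perfect : perfect W1 A.
Proof.
have [wfW _ _] := omega1_W1.
pose admissible (q : W1 * (A * side) * (W1 -> state)) :=
  (forall b, b < q.1.1 -> coherent (q.2 b)) /\
  (forall b b', b <= b' -> b' < q.1.1 -> (q.2 b').2 `<=` (q.2 b).2).
(* Dummy states answer inadmissible histories, so that [choice] yields a total [F]. *)
have step q : exists r : state * state, admissible q ->
    [/\ continues q.1.1 q.1.2 q.2 r.1, continues q.1.1 q.1.2 q.2 r.2 &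
      contradictory r.1.1 r.2.1].
  have [[cohq monoq]|nadm] := pselect (admissible q); last first.
    by exists ((set0, set0), (set0, set0)).
  by have [r ?] := next_states q.1.2 cohq monoq; exists r.
have [F FP] := choice step.
pose pick (r : state * state) (b : bool) := if b then r.1 else r.2.
pose r0 : state * state := ((set0, set0), (set0, set0)).
pose G (cs : challenges W1 A * choices W1) a (h : W1 -> state * state) :=
  F (a, cs.1 a, fun b => pick (h b) (cs.2 b)).
have [g gE] := choice (fun cs => wf_recursion r0 (G cs) wfW).
(* The two halves of [r0] coincide, so [H cs a] reveals neither the states nor the choices from
   round [a] on; this makes the strategy nonanticipating. *)
pose H cs a b := pick (if b < a then g cs b else r0) (cs.2 b).
have gF c s a : g (c, s) a = F (a, c a, H (c, s) a) by rewrite gE.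
have Hlt cs a b : b < a -> H cs a b = pick (g cs b) (cs.2 b) by rewrite /H => ->.
have adm c s a : admissible (a, c a, H (c, s) a).
  elim/(well_founded_ind wfW): a => a IH.
  have cont b : b < a -> continues b (c b) (H (c, s) b) (H (c, s) a b).
    move=> ba; rewrite Hlt // gF.
    by have [c1 c2 _] := FP _ (IH b ba); rewrite /pick /=; case: (s b).
  split=> /= [b /cont[] //|b b' +].
  rewrite le_eqVlt => /orP[/eqP ->|bb'] b'a; first exact: subset_refl.
  have [_ /(_ b bb') + _] := cont b' b'a.
  by rewrite (Hlt _ b' b bb') (Hlt _ a b (lt_trans bb' b'a)).
pose tau a c s : answer A := ((g (c, s) a).1.1, (g (c, s) a).2.1).
exists tau.
  move=> a c c' s s' cc' ss'; suff : g (c, s) a = g (c', s') a by rewrite /tau => ->.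
  elim/(well_founded_ind wfW): a cc' ss' => a IH cc' ss'.
  rewrite !gF cc' //; congr (F (_, _, _)); apply/funext => b; rewrite /H /=.
  case: ifP => [ba|_]; last by case: (s b) (s' b) => -[].
  rewrite ss' // IH // => e eb.
    exact/cc'/(le_trans eb)/ltW.
  exact/ss'/(lt_trans eb).
move=> c s a.
(* The actual position is the union of the first components of the chosen states, so legality can be
   read off from [continues]. *)
have posE : position tau c s a = \bigcup_(b in [set b | b < a]) (H (c, s) a b).1.
  apply: eq_bigcupr => b ba; rewrite Hlt //.
  by rewrite /pick /chosen /tau /=; case: (s b).
have [[_ _ leg1] [_ _ leg2] con] := FP _ (adm c s a).
by rewrite /tau posE gF; split.
Qed.

End StrategyFromIdeal.

(** * The equivalence of the three conditions *)

Lemma many_automorphisms_perfect d1 d2 (W1 : orderType d1) (W2 : orderType d2)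
    (L : vocabulary) (A : model L) :
    is_omega1 W1 -> is_omega2 W1 W2 -> I_omega W1 W2 ->
    [set: A] #= [set: W1] -> [set: W1] #< automorphisms A ->
  perfect W1 A.
Proof.
move=> omega1_W1 [wfW2 _ small] [I [properI completeI _ singI [K denseK boundedK]]].
move=> /card_eqPle[leA _] [_ nle].
have [f inj_f aut_f] := wo_embedding wfW2 small nle.
exact: (ideal_perfect omega1_W1 leA properI completeI singI denseK boundedK inj_f aut_f).
Qed.

Lemma lt_card_power d (W1 : orderType d) (T : Type) (S : set T) :
  S #= [set: set W1] -> [set: W1] #< S.
Proof.
move=> /card_eqPle[_ leS]; split; last by move=> /(card_le_trans leS)/Cantor.
apply: card_le_trans leS; apply: (@inj_card_leT _ _ (@set1 W1)) => x y xy.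
by have : [set y] x by rewrite -xy.
Qed.

Theorem corollary13 (d1 d2 : Order.disp_t)
    (W1 : orderType d1) (W2 : orderType d2)
    (omega1_W1 : is_omega1 W1) (omega2_W2 : is_omega2 W1 W2)
    (I_om : I_omega W1 W2)
    (L : vocabulary) (A : model L) (card_A : [set: A] #= [set: W1]) :
  ([set: W1] #< automorphisms A <-> automorphisms A #= [set: set W1]) /\
  (automorphisms A #= [set: set W1] <-> perfect W1 A).
Proof.
(* The implications form the cycle (i) to (iii) to (ii) to (i), the last by Cantor's theorem. *)
have i_iii := many_automorphisms_perfect omega1_W1 omega2_W2 I_om card_A.
have iii_ii := perfect_card_automorphisms omega1_W1 card_A.
have ii_i := @lt_card_power _ W1 _ (automorphisms A).
split; first by split=> [/i_iii/iii_ii|/ii_i].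
by split=> [/ii_i/i_iii|/iii_ii].
Qed.
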